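(* Let $f_1,f_2:\mathbb{R}^n\to\mathbb{R}$. If $f_1,f_2$ are CN functions on $S$, then $\alpha_1f_1+\alpha_2f_2$ is a CN function on $S$ for any $\alpha_1,\alpha_2>0$; and the same statement holds with ''CN'' replaced throughout (in hypothesis and conclusion) by any one of ''weak uniform CN'', ''strong uniform CN'', ''exact CN'', ''weak uniform exact CN'', ''strong uniform exact CN''. Moreover, if $f_1,f_2$ are exact CN functions on $S$, then $\alpha_1f_1+\alpha_2f_2$ is an exact CN function on $S$ for any $\alpha_1,\alpha_2\in\mathbb{R}$.
   Context: Let $S_1\subset\mathbb{R}^n$ be a convex set. A function $f:\mathbb{R}^n\to\mathbb{R}$ is a CN (convertible nonconvex) function on $S$ if there are $m$, a convex set $S=S_1\times S_2\subset\mathbb{R}^n\times\mathbb{R}^m$, and functions $g,g_1,\dots,g_r:\mathbb{R}^n\times\mathbb{R}^m\to\mathbb{R}$ ($r\ge1$), all convex on $S$, such that, with $X(\bm g)=\{(\bm x,\bm y)\in S: g_i(\bm x,\bm y)=0,\ i=1,\dots,r\}$, for each $\bm x\in S_1$ there is $\bm y\in\mathbb{R}^m$ with $(\bm x,\bm y)\in X(\bm g)$ and $f(\bm x)=g(\bm x,\bm y)=\min_{(\bm x,\bm y')\in X(\bm g)}g(\bm x,\bm y')$. It is an exact CN function on $S$ if such data exist for which, moreover, for each $\bm x\in S_1$ there is $\bm y$ with $(\bm x,\bm y)\in X(\bm g)$ and $f(\bm x)=g(\bm x,\bm y)=g(\bm x,\bm y')$ for all $\bm y'$ with $(\bm x,\bm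 y')\in X(\bm g)$. A CN (resp. exact CN) function is weak uniform (resp. strong uniform) if in such data $g$ can be chosen weak uniform convex (resp. strong uniform convex) on $S$: $g$ is differentiable and for every $\bm w\in S$ there is a positive semidefinite (resp. positive definite) symmetric matrix $B(\bm w)$ with $g(\bm w+\bm d)-g(\bm w)\ge\nabla g(\bm w)^\top\bm d+\frac12\bm d^\top B(\bm w)\bm d$ for all $\bm d$ with $\bm w+\bm d\in S$. When ''on $S$'' is asserted of several functions, $S_1$ is the same for all of them, while the number $m$ of auxiliary variables and the factor $S_2$ may differ from function to function. *)

(* Defs.v *)
From HB Require Import structures.
From mathcomp Require Import all_boot all_order all_algebra.
From mathcomp Require Import all_classical all_reals all_analysis.

Set Implicit Arguments.
Unset Strict Implicit.
Unset Printing Implicit Defensive.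

Import Order.TTheory GRing.Theory Num.Theory.
Import numFieldNormedType.Exports.

Local Open Scope classical_set_scope.
Local Open Scope ring_scope.

(* R^n x R^m is identified with R^(n+m): the pair (x, y) is [col_mx x y]. *)
Definition prod_set (R : realType) (n m : nat)
    (S1 : set 'cV[R]_n) (S2 : set 'cV[R]_m) : set 'cV[R]_(n + m) :=
  [set w | S1 (usubmx w) /\ S2 (dsubmx w)].

(* The Euclidean inner product u^T v, the entry of a 1 x 1 matrix. *)
Definition dot (R : realType) (p : nat) (u v : 'cV[R]_p) : R :=
  (u^T *m v) ord0 ord0.

Definition gradient (R : realType) (p : nat) (g : 'cV[R]_p -> R)
    (w : 'cV[R]_p) : 'cV[R]_p :=
  \col_i 'D_(delta_mx i ord0) g w.

Definition sym_psd (R : realType) (p : nat) (B : 'M[R]_p) : Prop :=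
  B^T = B /\ forall d : 'cV[R]_p, 0 <= dot d (B *m d).

Definition sym_pd (R : realType) (p : nat) (B : 'M[R]_p) : Prop :=
  B^T = B /\ forall d : 'cV[R]_p, d != 0 -> 0 < dot d (B *m d).

Definition quadratic_minorant (R : realType) (p : nat) (S : set 'cV[R]_p)
    (g : 'cV[R]_p -> R) (w : 'cV[R]_p) (B : 'M[R]_p) : Prop :=
  forall d : 'cV[R]_p, S (w + d) ->
    dot (gradient g w) d + 2^-1 * dot d (B *m d) <= g (w + d) - g w.

(* Differentiability is required on the whole space, on which g is defined;
   only the quadratic bound is relative to S. *)
Definition weak_uniform_convex (R : realType) (p : nat) (S : set 'cV[R]_p)
    (g : 'cV[R]_p -> R) : Prop :=
  (forall w : 'cV[R]_p, differentiable g w) /\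
  (forall w : 'cV[R]_p, S w ->
     exists B : 'M[R]_p, sym_psd B /\ quadratic_minorant S g w B).

Definition strong_uniform_convex (R : realType) (p : nat) (S : set 'cV[R]_p)
    (g : 'cV[R]_p -> R) : Prop :=
  (forall w : 'cV[R]_p, differentiable g w) /\
  (forall w : 'cV[R]_p, S w ->
     exists B : 'M[R]_p, sym_pd B /\ quadratic_minorant S g w B).

(* The set X(g) cut out of S by the equations g_i = 0. *)
Definition feasible (R : realType) (p r : nat) (S : set 'cV[R]_p)
    (gs : 'I_r -> 'cV[R]_p -> R) : set 'cV[R]_p :=
  [set w | S w /\ forall i, gs i w = 0].

Definition CN_data (R : realType) (n m r : nat)
    (S1 : set 'cV[R]_n) (S2 : set 'cV[R]_m)
    (g : 'cV[R]_(n + m) -> R) (gs : 'I_r -> 'cV[R]_(n + m) -> R)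
    (f : 'cV[R]_n -> R) : Prop :=
  [/\ (0 < r)%N,
      @convex_set R 'cV[R]_(n + m) (prod_set S1 S2),
      @convex_function R 'cV[R]_(n + m) (prod_set S1 S2) g,
      forall i, @convex_function R 'cV[R]_(n + m) (prod_set S1 S2) (gs i) &
      forall x, S1 x -> exists y : 'cV[R]_m,
        [/\ feasible (prod_set S1 S2) gs (col_mx x y),
            f x = g (col_mx x y) &
            forall y' : 'cV[R]_m, feasible (prod_set S1 S2) gs (col_mx x y') ->
              g (col_mx x y) <= g (col_mx x y')]].

Definition exact_CN_data (R : realType) (n m r : nat)
    (S1 : set 'cV[R]_n) (S2 : set 'cV[R]_m)
    (g : 'cV[R]_(n + m) -> R) (gs : 'I_r -> 'cV[R]_(n + m) -> R)
    (f : 'cV[R]_n -> R) : Prop :=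
  CN_data S1 S2 g gs f /\
  forall x, S1 x -> exists y : 'cV[R]_m,
    [/\ feasible (prod_set S1 S2) gs (col_mx x y),
        f x = g (col_mx x y) &
        forall y' : 'cV[R]_m, feasible (prod_set S1 S2) gs (col_mx x y') ->
          g (col_mx x y) = g (col_mx x y')].

(* The predicates below depend on S1 only: m and the factor S2 belong to the
   existentially quantified data, so they may vary with the function f. *)
Definition CN (R : realType) (n : nat) (S1 : set 'cV[R]_n)
    (f : 'cV[R]_n -> R) : Prop :=
  exists (m r : nat) (S2 : set 'cV[R]_m) (g : 'cV[R]_(n + m) -> R)
         (gs : 'I_r -> 'cV[R]_(n + m) -> R),
    CN_data S1 S2 g gs f.

Definition weak_uniform_CN (R : realType) (n : nat) (S1 : set 'cV[R]_n)
    (f : 'cV[R]_n -> R) : Prop :=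
  exists (m r : nat) (S2 : set 'cV[R]_m) (g : 'cV[R]_(n + m) -> R)
         (gs : 'I_r -> 'cV[R]_(n + m) -> R),
    CN_data S1 S2 g gs f /\ weak_uniform_convex (prod_set S1 S2) g.

Definition strong_uniform_CN (R : realType) (n : nat) (S1 : set 'cV[R]_n)
    (f : 'cV[R]_n -> R) : Prop :=
  exists (m r : nat) (S2 : set 'cV[R]_m) (g : 'cV[R]_(n + m) -> R)
         (gs : 'I_r -> 'cV[R]_(n + m) -> R),
    CN_data S1 S2 g gs f /\ strong_uniform_convex (prod_set S1 S2) g.

Definition exact_CN (R : realType) (n : nat) (S1 : set 'cV[R]_n)
    (f : 'cV[R]_n -> R) : Prop :=
  exists (m r : nat) (S2 : set 'cV[R]_m) (g : 'cV[R]_(n + m) -> R)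
         (gs : 'I_r -> 'cV[R]_(n + m) -> R),
    exact_CN_data S1 S2 g gs f.

Definition weak_uniform_exact_CN (R : realType) (n : nat) (S1 : set 'cV[R]_n)
    (f : 'cV[R]_n -> R) : Prop :=
  exists (m r : nat) (S2 : set 'cV[R]_m) (g : 'cV[R]_(n + m) -> R)
         (gs : 'I_r -> 'cV[R]_(n + m) -> R),
    exact_CN_data S1 S2 g gs f /\ weak_uniform_convex (prod_set S1 S2) g.

Definition strong_uniform_exact_CN (R : realType) (n : nat)
    (S1 : set 'cV[R]_n) (f : 'cV[R]_n -> R) : Prop :=
  exists (m r : nat) (S2 : set 'cV[R]_m) (g : 'cV[R]_(n + m) -> R)
         (gs : 'I_r -> 'cV[R]_(n + m) -> R),
    exact_CN_data S1 S2 g gs f /\ strong_uniform_convex (prod_set S1 S2) g.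

(* Main.v *)
Require Import Defs.
From mathcomp Require Import all_boot all_order all_algebra.
From mathcomp Require Import all_classical all_reals all_analysis.

Import Order.TTheory GRing.Theory Num.Theory.
Import numFieldNormedType.Exports.

Local Open Scope classical_set_scope.
Local Open Scope ring_scope.

Set Implicit Arguments.
Unset Strict Implicit.
Unset Printing Implicit Defensive.

(** Two sets of data for f1 and f2 share the variable x but have separate
    auxiliary variables y1 and y2.  On triples (x, y1, y2) take both families
    of constraints together and the objective g1(x, y1) + g2(x, y2).  For a
    fixed x the feasible set is then the product of the two original ones, so
    minimizing the sum amounts to minimizing each term, and a sum that is
    constant term by term is constant: the glued data represent f1 + f2
    ([CN_data_glue], [exact_CN_data_glue]).  Multiplying the objective by a
    positive scalar settles positive coefficients.

    The glued objective is the sum of g1 and g2 composed with the linear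
    projections P1 : (x, y1, y2) |-> (x, y1) and P2 : (x, y1, y2) |-> (x, y2),
    hence convex.  If B1 and B2 witness uniform convexity of g1 and g2, then
    P1^T B1 P1 + P2^T B2 P2 witnesses it for the sum, because the gradient of
    g o P paired with d is the gradient of g paired with P d.  This matrix is
    positive definite when B1 and B2 are, since d is recovered from P1 d and
    P2 d ([strong_uniform_convex_glue], [proj_mx_inj]).

    For exact functions and arbitrary signs, a negative multiple of g is no
    longer convex, so g is moved out of the objective: a new variable z with
    the constraint g(x, y) - z = 0, which is convex in (x, y, z), is
    introduced.  By exactness every feasible point has z = f(x), and a z is a
    linear, hence convex, objective for any real a
    ([exact_CN_data_scale_any]).  Exactness is what makes this work: otherwise
    a negative a would select the largest value of g over the feasible points
    instead of the least one. *)

(** * Convexity under linear substitution and linear combination *)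

Section Convexity.
Variables (R : realType) (p q : nat).
Implicit Types (S : set 'cV[R]_q) (T : set 'cV[R]_p).

Lemma convex_set_preimage (A : 'M[R]_(p, q)) T :
  @convex_set R 'cV[R]_p T -> @convex_set R 'cV[R]_q [set w | T (A *m w)].
Proof.
move=> cT x y t; rewrite !inE /= => Tx Ty.
have := cT (A *m x) (A *m y) t.
by rewrite !inE /conv /= mulmxDr -!scalemxAr; exact.
Qed.

Lemma convex_function_comp (A : 'M[R]_(p, q)) S T (g : 'cV[R]_p -> R) :
  (forall w, S w -> T (A *m w)) ->
  @convex_function R 'cV[R]_p T g ->
  @convex_function R 'cV[R]_q S (fun w => g (A *m w)).
Proof.
move=> ST cg t x y; rewrite !inE => Sx Sy.
have := cg t (A *m x) (A *m y).
by rewrite !inE /conv /= mulmxDr -!scalemxAr; apply; exact: ST.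
Qed.

Lemma convex_functionD S (g h : 'cV[R]_q -> R) :
  @convex_function R 'cV[R]_q S g -> @convex_function R 'cV[R]_q S h ->
  @convex_function R 'cV[R]_q S (fun w => g w + h w).
Proof.
move=> cg ch t x y Sx Sy.
apply: le_trans (lerD (cg t x y Sx Sy) (ch t x y Sx Sy)) _.
by rewrite !convRE !mulrDr addrACA.
Qed.

Lemma convex_functionZ S (a : R) (g : 'cV[R]_q -> R) : 0 <= a ->
  @convex_function R 'cV[R]_q S g ->
  @convex_function R 'cV[R]_q S (fun w => a * g w).
Proof.
move=> a0 cg t x y Sx Sy; apply: le_trans (ler_wpM2l a0 (cg t x y Sx Sy)) _.
by rewrite !convRE mulrDr !(mulrCA a).
Qed.

(** A linear objective stays convex under multiplication by negative scalars,
    which is what frees the signs of the coefficients. *)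
Lemma convex_function_linear S (a : R) (L : 'rV[R]_q) :
  @convex_function R 'cV[R]_q S (fun w => a * (L *m w) ord0 ord0).
Proof.
move=> t x y _ _.
rewrite !convRE [conv _ _ _]/conv /= mulmxDr -!scalemxAr !mxE mulrDr.
by rewrite !(mulrCA a).
Qed.

End Convexity.

(** * Gradients and quadratic minorants *)

Section Minorants.
Variable R : realType.

(** A v is a linear combination of the columns of A whose coefficients are
    the coordinates of v, each of them a differentiable function. *)
Lemma differentiable_mulmx p q (A : 'M[R]_(p, q)) (w : 'cV[R]_q) :
  differentiable (fun v : 'cV[R]_q => A *m v) w.
Proof.
have -> : (fun v : 'cV[R]_q => A *m v) =
          \sum_(j < q) (fun v : 'cV[R]_q => v j ord0 *: col j A).
  apply/funext => v; rewrite fct_sumE; apply/matrixP => i k.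
  rewrite summxE mxE; apply: eq_bigr => j _.
  by rewrite !mxE mulrC (ord1 k).
apply: differentiable_sum => j.
exact/differentiableZl/differentiable_coord.
Qed.

Lemma diff_mulmx p q (A : 'M[R]_(p, q)) (w : 'cV[R]_q) :
  'd (fun v : 'cV[R]_q => A *m v) w = (fun v => A *m v) :> (_ -> _).
Proof.
apply: (@diff_lin _ _ _ (mulmx A : {linear 'cV[R]_q -> 'cV[R]_p})) => v.
exact/differentiable_continuous/differentiable_mulmx.
Qed.

Lemma dotDr p (u v w : 'cV[R]_p) : dot u (v + w) = dot u v + dot u w.
Proof. by rewrite /dot mulmxDr mxE. Qed.

Lemma dotZr p (a : R) (u v : 'cV[R]_p) : dot u (a *: v) = a * dot u v.
Proof. by rewrite /dot -scalemxAr mxE. Qed.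

(** Turns the vector of partial derivatives into the differential, for which
    sum, scaling and chain rules are available. *)
Lemma dot_gradient p (g : 'cV[R]_p -> R) (w d : 'cV[R]_p) :
  differentiable g w -> dot (gradient g w) d = 'd g w d.
Proof.
move=> dg; rewrite /dot mxE.
have {2}-> : d = \sum_(j < p) d j ord0 *: delta_mx j ord0.
  rewrite {1}[d]matrix_sum_delta; apply: eq_bigr => j _.
  by rewrite big_ord1.
rewrite linear_sum; apply: eq_bigr => j _.
by rewrite linearZ !mxE deriveE // mulrC.
Qed.

(** By the chain rule both sides of the bound for g o A at w in the direction
    d are those of the bound for g at A w in the direction A d. *)
Lemma quadratic_minorant_comp p q (A : 'M[R]_(p, q)) (S : set 'cV[R]_q)
    (T : set 'cV[R]_p) (g : 'cV[R]_p -> R) (w : 'cV[R]_q) (B : 'M[R]_p) :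
  (forall v, S v -> T (A *m v)) -> differentiable g (A *m w) ->
  quadratic_minorant T g (A *m w) B ->
  quadratic_minorant S (fun v => g (A *m v)) w (A^T *m B *m A).
Proof.
move=> ST dg gB d Sd.
have dA := differentiable_mulmx A w.
rewrite dot_gradient; last exact: (differentiable_comp dA dg).
rewrite (diff_comp dA dg) /= diff_mulmx -dot_gradient //.
rewrite mulmxDr.
have -> : dot d (A^T *m B *m A *m d) = dot (A *m d) (B *m (A *m d)).
  by rewrite /dot trmx_mul !mulmxA.
by apply: gB; rewrite -mulmxDr; exact: ST.
Qed.

Lemma quadratic_minorantD p (S : set 'cV[R]_p) (g h : 'cV[R]_p -> R)
    (w : 'cV[R]_p) (B C : 'M[R]_p) :
  differentiable g w -> differentiable h w ->
  quadratic_minorant S g w B -> quadratic_minorant S h w C ->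
  quadratic_minorant S (fun v => g v + h v) w (B + C).
Proof.
move=> dg dh gB hC d Sd.
rewrite dot_gradient; last exact: (differentiableD dg dh).
rewrite (diffD dg dh) /= -!dot_gradient // mulmxDl dotDr mulrDr addrACA.
by rewrite opprD [leRHS]addrACA; apply: lerD; [exact: gB | exact: hC].
Qed.

Lemma quadratic_minorantZ p (S : set 'cV[R]_p) (a : R) (g : 'cV[R]_p -> R)
    (w : 'cV[R]_p) (B : 'M[R]_p) :
  0 <= a -> differentiable g w -> quadratic_minorant S g w B ->
  quadratic_minorant S (fun v => a * g v) w (a *: B).
Proof.
move=> a0 dg gB d Sd.
rewrite dot_gradient; last exact: (differentiableZ a dg).
rewrite (diffZ a dg) /= -dot_gradient // -scalemxAl dotZr mulrCA -mulrDr -mulrBr.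
by apply: ler_wpM2l => //; exact: gB.
Qed.

End Minorants.

(** * Uniform convexity of scaled and glued functions *)

Section UniformConvexity.
Variable R : realType.

Lemma weak_uniform_convexZ p (S : set 'cV[R]_p) (a : R) (g : 'cV[R]_p -> R) :
  0 < a -> weak_uniform_convex S g ->
  weak_uniform_convex S (fun w => a * g w).
Proof.
move=> a0 [dg gB]; split=> [w|w /gB[B [[sB pB] mB]]].
  exact: (differentiableZ a (dg w)).
exists (a *: B); split; last exact: quadratic_minorantZ (ltW a0) (dg w) mB.
split=> [|d]; first by rewrite linearZ /= sB.
by rewrite -scalemxAl dotZr mulr_ge0 // ltW.
Qed.

Lemma strong_uniform_convexZ p (S : set 'cV[R]_p) (a : R) (g : 'cV[R]_p -> R) :
  0 < a -> strong_uniform_convex S g ->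
  strong_uniform_convex S (fun w => a * g w).
Proof.
move=> a0 [dg gB]; split=> [w|w /gB[B [[sB pB] mB]]].
  exact: (differentiableZ a (dg w)).
exists (a *: B); split; last exact: quadratic_minorantZ (ltW a0) (dg w) mB.
split=> [|d d0]; first by rewrite linearZ /= sB.
by rewrite -scalemxAl dotZr mulr_gt0 // pB.
Qed.

Section Glue.
Variables (p1 p2 q : nat) (A1 : 'M[R]_(p1, q)) (A2 : 'M[R]_(p2, q)).
Variables (S : set 'cV[R]_q) (T1 : set 'cV[R]_p1) (T2 : set 'cV[R]_p2).
Hypotheses (ST1 : forall w, S w -> T1 (A1 *m w))
           (ST2 : forall w, S w -> T2 (A2 *m w)).
Variables (g1 : 'cV[R]_p1 -> R) (g2 : 'cV[R]_p2 -> R).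

Let g w := g1 (A1 *m w) + g2 (A2 *m w).
Let glueB (B1 : 'M[R]_p1) (B2 : 'M[R]_p2) :=
  A1^T *m B1 *m A1 + A2^T *m B2 *m A2.

Let glueB_sym B1 B2 : B1^T = B1 -> B2^T = B2 -> (glueB B1 B2)^T = glueB B1 B2.
Proof.
move=> s1 s2; rewrite /glueB linearD /= !trmx_mul !trmxK s1 s2.
by rewrite !mulmxA.
Qed.

Let dot_glueB B1 B2 d :
  dot d (glueB B1 B2 *m d) =
  dot (A1 *m d) (B1 *m (A1 *m d)) + dot (A2 *m d) (B2 *m (A2 *m d)).
Proof. by rewrite /glueB mulmxDl dotDr /dot !trmx_mul !mulmxA. Qed.

Let differentiable_comp_mulmx p (A : 'M[R]_(p, q)) (h : 'cV[R]_p -> R) w :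
  (forall v, differentiable h v) -> differentiable (fun v => h (A *m v)) w.
Proof.
by move=> dh; exact: (differentiable_comp (differentiable_mulmx A w) (dh _)).
Qed.

Let differentiable_glue w : (forall v, differentiable g1 v) ->
  (forall v, differentiable g2 v) -> differentiable g w.
Proof.
move=> d1 d2; exact: (differentiableD (differentiable_comp_mulmx _ _ d1)
                                      (differentiable_comp_mulmx _ _ d2)).
Qed.

Let glue_minorant w B1 B2 :
  (forall v, differentiable g1 v) -> (forall v, differentiable g2 v) ->
  quadratic_minorant T1 g1 (A1 *m w) B1 ->
  quadratic_minorant T2 g2 (A2 *m w) B2 ->
  quadratic_minorant S g w (glueB B1 B2).
Proof.
move=> d1 d2 m1 m2.
apply: quadratic_minorantD; do ?exact: differentiable_comp_mulmx.
- exact: quadratic_minorant_comp ST1 (d1 _) m1.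
- exact: quadratic_minorant_comp ST2 (d2 _) m2.
Qed.

Lemma weak_uniform_convex_glue :
  weak_uniform_convex T1 g1 -> weak_uniform_convex T2 g2 ->
  weak_uniform_convex S g.
Proof.
move=> [d1 u1] [d2 u2]; split=> [w|w Sw]; first exact: differentiable_glue.
have [B1 [[s1 p1B] m1]] := u1 _ (ST1 Sw).
have [B2 [[s2 p2B] m2]] := u2 _ (ST2 Sw).
exists (glueB B1 B2); split; last exact: glue_minorant.
by split=> [|d]; [exact: glueB_sym | rewrite dot_glueB addr_ge0].
Qed.

(** Each pulled-back form is in general only semidefinite: it is 0 on the kernel
    of its matrix; the sum is definite because the two kernels meet only
    in 0. *)
Lemma strong_uniform_convex_glue :
  (forall d : 'cV[R]_q, A1 *m d = 0 -> A2 *m d = 0 -> d = 0) ->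
  strong_uniform_convex T1 g1 -> strong_uniform_convex T2 g2 ->
  strong_uniform_convex S g.
Proof.
move=> inj [d1 u1] [d2 u2]; split=> [w|w Sw]; first exact: differentiable_glue.
have [B1 [[s1 p1B] m1]] := u1 _ (ST1 Sw).
have [B2 [[s2 p2B] m2]] := u2 _ (ST2 Sw).
exists (glueB B1 B2); split; last exact: glue_minorant.
split=> [|d d0]; first exact: glueB_sym.
have dot0 p (B : 'M[R]_p) : dot 0 (B *m 0) = 0.
  by rewrite /dot mulmx0 mulmx0 mxE.
rewrite dot_glueB; have [e1|n1] := eqVneq (A1 *m d) 0; last first.
  have [->|n2] := eqVneq (A2 *m d) 0; first by rewrite dot0 addr0 p1B.
  by rewrite addr_gt0 ?p1B ?p2B.
have [e2|n2] := eqVneq (A2 *m d) 0; last by rewrite e1 dot0 add0r p2B.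
by rewrite (inj _ e1 e2) eqxx in d0.
Qed.

End Glue.
End UniformConvexity.

(** * Gluing data along the shared variables *)

Section Glued_data.
Variables (R : realType) (n m1 m2 : nat).

(** The projections are matrices rather than functions so that one argument
    about [g (A *m w)] covers convexity, differentiability and pulled-back
    quadratic forms. *)
Definition proj1_mx : 'M[R]_(n + m1, n + (m1 + m2)) :=
  block_mx 1%:M 0 0 (row_mx 1%:M 0).

Definition proj2_mx : 'M[R]_(n + m2, n + (m1 + m2)) :=
  block_mx 1%:M 0 0 (row_mx 0 1%:M).

Lemma proj1_mxE (x : 'cV[R]_n) (y1 : 'cV[R]_m1) (y2 : 'cV[R]_m2) :
  proj1_mx *m col_mx x (col_mx y1 y2) = col_mx x y1.
Proof.
by rewrite mul_block_col mul_row_col !mul1mx !mul0mx !addr0 add0r.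
Qed.

Lemma proj2_mxE (x : 'cV[R]_n) (y1 : 'cV[R]_m1) (y2 : 'cV[R]_m2) :
  proj2_mx *m col_mx x (col_mx y1 y2) = col_mx x y2.
Proof.
by rewrite mul_block_col mul_row_col !mul1mx !mul0mx !addr0 !add0r.
Qed.

Lemma split3_mx (w : 'cV[R]_(n + (m1 + m2))) : exists x y1 y2,
  w = col_mx x (col_mx y1 y2).
Proof.
by exists (usubmx w), (usubmx (dsubmx w)), (dsubmx (dsubmx w)); rewrite !vsubmxK.
Qed.

Lemma proj_mx_inj (d : 'cV[R]_(n + (m1 + m2))) :
  proj1_mx *m d = 0 -> proj2_mx *m d = 0 -> d = 0.
Proof.
have [x [y1 [y2 ->]]] := split3_mx d; rewrite proj1_mxE proj2_mxE.
move=> /eqP; rewrite col_mx_eq0 => /andP[/eqP-> /eqP->] /eqP.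
by rewrite col_mx_eq0 => /andP[_ /eqP->]; rewrite !col_mx0.
Qed.

Variables (S1 : set 'cV[R]_n) (T1 : set 'cV[R]_m1) (T2 : set 'cV[R]_m2).

Lemma prod_set_proj (w : 'cV[R]_(n + (m1 + m2))) :
  prod_set S1 (prod_set T1 T2) w <->
  prod_set S1 T1 (proj1_mx *m w) /\ prod_set S1 T2 (proj2_mx *m w).
Proof.
have [x [y1 [y2 ->]]] := split3_mx w; rewrite proj1_mxE proj2_mxE.
rewrite /prod_set /= !(col_mxKu, col_mxKd); tauto.
Qed.

End Glued_data.

Definition glue_constraints (R : realType) (n m1 m2 r1 r2 : nat)
    (gs1 : 'I_r1 -> 'cV[R]_(n + m1) -> R)
    (gs2 : 'I_r2 -> 'cV[R]_(n + m2) -> R)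
    (i : 'I_(r1 + r2)) (w : 'cV[R]_(n + (m1 + m2))) : R :=
  match fintype.split i with
  | inl j => gs1 j (proj1_mx R n m1 m2 *m w)
  | inr j => gs2 j (proj2_mx R n m1 m2 *m w)
  end.

Section Sum.
Variables (R : realType) (n m1 m2 r1 r2 : nat) (S1 : set 'cV[R]_n).
Variables (T1 : set 'cV[R]_m1) (T2 : set 'cV[R]_m2).
Variables (g1 : 'cV[R]_(n + m1) -> R) (g2 : 'cV[R]_(n + m2) -> R).
Variables (gs1 : 'I_r1 -> 'cV[R]_(n + m1) -> R)
          (gs2 : 'I_r2 -> 'cV[R]_(n + m2) -> R).

Let P1 := proj1_mx R n m1 m2.
Let P2 := proj2_mx R n m1 m2.
Let T := prod_set T1 T2.
Let gs := glue_constraints gs1 gs2.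

Definition glue_objective w := g1 (P1 *m w) + g2 (P2 *m w).
Let g := glue_objective.

Let ST1 w : prod_set S1 T w -> prod_set S1 T1 (P1 *m w).
Proof. by move=> /prod_set_proj[]. Qed.

Let ST2 w : prod_set S1 T w -> prod_set S1 T2 (P2 *m w).
Proof. by move=> /prod_set_proj[]. Qed.

(** For a fixed x the feasible pairs (y1, y2) form a product: nothing links y1
    to y2. *)
Lemma feasible_glue w :
  feasible (prod_set S1 T) gs w <->
  feasible (prod_set S1 T1) gs1 (P1 *m w) /\
  feasible (prod_set S1 T2) gs2 (P2 *m w).
Proof.
split=> [[/prod_set_proj[w1 w2] gs0]|[[w1 gs10] [w2 gs20]]].
  split; split=> // i.
  - by have := gs0 (lshift r2 i); rewrite /gs /glue_constraints (unsplitK (inl i)).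
  - by have := gs0 (rshift r1 i); rewrite /gs /glue_constraints (unsplitK (inr i)).
split=> [|i]; first exact/prod_set_proj.
by rewrite /gs /glue_constraints; case: (fintype.split _).
Qed.

(** A sum of functions of independent variables is minimized termwise. *)
Lemma CN_data_glue f1 f2 :
  CN_data S1 T1 g1 gs1 f1 -> CN_data S1 T2 g2 gs2 f2 ->
  CN_data S1 T g gs (fun x => f1 x + f2 x).
Proof.
move=> [r1_gt0 cS1 cg1 cgs1 min1] [r2_gt0 cS2 cg2 cgs2 min2]; split.
- by rewrite addn_gt0 r1_gt0.
- move=> x y t; rewrite !inE => /prod_set_proj[x1 x2] /prod_set_proj[y1 y2].
  have := convex_set_preimage (A := P1) cS1 (x := x) (y := y) t.
  have := convex_set_preimage (A := P2) cS2 (x := x) (y := y) t.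
  by rewrite !inE => c2 c1; apply/prod_set_proj; split; [exact: c1 | exact: c2].
- by apply: convex_functionD;
    [exact: convex_function_comp ST1 cg1 | exact: convex_function_comp ST2 cg2].
- move=> i; rewrite /gs /glue_constraints; case: (fintype.split _) => j.
  + exact: convex_function_comp ST1 (cgs1 j).
  + exact: convex_function_comp ST2 (cgs2 j).
move=> x Sx; have [y1 [F1 -> le1]] := min1 x Sx.
have [y2 [F2 -> le2]] := min2 x Sx.
exists (col_mx y1 y2); split.
- by apply/feasible_glue; rewrite proj1_mxE proj2_mxE.
- by rewrite /g /glue_objective proj1_mxE proj2_mxE.
move=> y'; rewrite -[y']vsubmxK => /feasible_glue.
rewrite /g /glue_objective !proj1_mxE !proj2_mxE => -[F1' F2'].
by apply: lerD; [exact: le1 | exact: le2].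
Qed.

Lemma exact_CN_data_glue f1 f2 :
  exact_CN_data S1 T1 g1 gs1 f1 -> exact_CN_data S1 T2 g2 gs2 f2 ->
  exact_CN_data S1 T g gs (fun x => f1 x + f2 x).
Proof.
move=> [D1 ex1] [D2 ex2]; split; first exact: CN_data_glue.
move=> x Sx; have [y1 [F1 -> eq1]] := ex1 x Sx.
have [y2 [F2 -> eq2]] := ex2 x Sx.
exists (col_mx y1 y2); split.
- by apply/feasible_glue; rewrite proj1_mxE proj2_mxE.
- by rewrite /g /glue_objective proj1_mxE proj2_mxE.
move=> y'; rewrite -[y']vsubmxK => /feasible_glue.
rewrite /g /glue_objective !proj1_mxE !proj2_mxE => -[F1' F2'].
by rewrite (eq1 _ F1') (eq2 _ F2').
Qed.

Lemma weak_uniform_glue_objective :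
  weak_uniform_convex (prod_set S1 T1) g1 ->
  weak_uniform_convex (prod_set S1 T2) g2 ->
  weak_uniform_convex (prod_set S1 T) g.
Proof. exact: weak_uniform_convex_glue. Qed.

Lemma strong_uniform_glue_objective :
  strong_uniform_convex (prod_set S1 T1) g1 ->
  strong_uniform_convex (prod_set S1 T2) g2 ->
  strong_uniform_convex (prod_set S1 T) g.
Proof. by apply: strong_uniform_convex_glue => // d; exact: proj_mx_inj. Qed.

End Sum.

(** * Positive multiples *)

Section Scaling.
Variables (R : realType) (n m r : nat) (S1 : set 'cV[R]_n) (S2 : set 'cV[R]_m).
Variables (g : 'cV[R]_(n + m) -> R) (gs : 'I_r -> 'cV[R]_(n + m) -> R).
Variable f : 'cV[R]_n -> R.

Lemma CN_dataZ a : 0 < a -> CN_data S1 S2 g gs f ->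
  CN_data S1 S2 (fun w => a * g w) gs (fun x => a * f x).
Proof.
move=> a0 [r0 cS cg cgs min]; split=> //.
  exact: convex_functionZ (ltW a0) cg.
move=> x Sx; have [y [F -> le]] := min x Sx.
by exists y; split=> // y' F'; rewrite ler_pM2l // le.
Qed.

Lemma exact_CN_dataZ a : 0 < a -> exact_CN_data S1 S2 g gs f ->
  exact_CN_data S1 S2 (fun w => a * g w) gs (fun x => a * f x).
Proof.
move=> a0 [D ex]; split; first exact: CN_dataZ.
move=> x Sx; have [y [F -> eq]] := ex x Sx.
by exists y; split=> // y' F'; rewrite (eq _ F').
Qed.

End Scaling.

(** * Arbitrary real multiples of exact functions *)

Section Graph.
Variables (R : realType) (n m r : nat) (S1 : set 'cV[R]_n) (S2 : set 'cV[R]_m).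
Variables (g : 'cV[R]_(n + m) -> R) (gs : 'I_r -> 'cV[R]_(n + m) -> R).
Variable f : 'cV[R]_n -> R.

Let P := proj1_mx R n m 1.

Definition last_coord : 'rV[R]_(n + (m + 1)) := row_mx 0 (row_mx 0 1%:M).

Let last_coordE (x : 'cV[R]_n) (y : 'cV[R]_m) (z : 'cV[R]_1) :
  last_coord *m col_mx x (col_mx y z) = z.
Proof. by rewrite !mul_row_col !mul0mx mul1mx !add0r. Qed.

Let z_of (w : 'cV[R]_(n + (m + 1))) : R := (last_coord *m w) ord0 ord0.

(** The added equation says that the point lies on the graph of g, with
    z = g (x, y); it is a convex function of (x, y, z), being g minus a linear
    form. *)
Definition graph_constraints (i : 'I_(r + 1)) (w : 'cV[R]_(n + (m + 1))) :=
  match fintype.split i with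
  | inl j => gs j (P *m w)
  | inr _ => g (P *m w) + (-1) * z_of w
  end.

Let T : set 'cV[R]_(m + 1) := prod_set S2 setT.

(* The factor for z is the whole line, so only (x, y) is constrained. *)
Let ST w : prod_set S1 T w <-> prod_set S1 S2 (P *m w).
Proof.
split=> [/prod_set_proj[]//|Pw]; apply/prod_set_proj; split=> //.
move: Pw; have [x [y [z ->]]] := split3_mx w; rewrite proj1_mxE proj2_mxE.
by rewrite /prod_set /= !(col_mxKu, col_mxKd) => -[].
Qed.

Let feasible_graph (x : 'cV[R]_n) (y : 'cV[R]_m) (z : 'cV[R]_1) :
  feasible (prod_set S1 T) graph_constraints (col_mx x (col_mx y z)) <->
  feasible (prod_set S1 S2) gs (col_mx x y) /\ z ord0 ord0 = g (col_mx x y).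
Proof.
rewrite /feasible /= ST /graph_constraints proj1_mxE /z_of last_coordE.
split=> [[Sxy gs0]|[[Sxy gs0] zE]].
  split; first split=> // i.
    by have := gs0 (lshift 1 i); rewrite (unsplitK (inl i)).
  have := gs0 (rshift r ord0); rewrite (unsplitK (inr ord0)) mulN1r => /eqP.
  by rewrite subr_eq0 => /eqP.
by split=> // i; case: (fintype.split _) => j //; rewrite zE mulN1r subrr.
Qed.

(** On the feasible set z is forced to equal g (x, y), and exactness of the
    original data makes that value f x at every feasible y.  The objective
    a z is therefore constant there, whatever the sign of a. *)
Lemma exact_CN_data_scale_any (a : R) : exact_CN_data S1 S2 g gs f ->
  exact_CN_data S1 T (fun w => a * (last_coord *m w) ord0 ord0)
    graph_constraints (fun x => a * f x).
Proof.
move=> [[r0 cS cg cgs _] ex].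
(* A point at which the objective equals its value at every feasible point is
   also a minimizer, so this gives both the CN and the exactness clauses. *)
have attained x : S1 x -> exists y : 'cV[R]_(m + 1),
    [/\ feasible (prod_set S1 T) graph_constraints (col_mx x y),
        a * f x = a * (last_coord *m col_mx x y) ord0 ord0 &
        forall y' : 'cV[R]_(m + 1),
          feasible (prod_set S1 T) graph_constraints (col_mx x y') ->
          a * (last_coord *m col_mx x y) ord0 ord0 =
          a * (last_coord *m col_mx x y') ord0 ord0].
  move=> Sx; have [y [F -> eq]] := ex x Sx.
  exists (col_mx y (g (col_mx x y))%:M); rewrite last_coordE mxE mulr1n.
  split=> // [|y']; first by apply/feasible_graph; rewrite mxE mulr1n.
  rewrite -[y']vsubmxK => /feasible_graph[F' zE].
  by rewrite last_coordE zE (eq _ F').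
split=> //; split.
- by rewrite addn1.
- move=> x y t; rewrite !inE !ST => Sx Sy.
  have := convex_set_preimage (A := P) cS (x := x) (y := y) t.
  by rewrite !inE; exact.
- exact: convex_function_linear.
- have STw w : prod_set S1 T w -> prod_set S1 S2 (P *m w) by move/ST.
  move=> i; rewrite /graph_constraints; case: (fintype.split _) => j.
    exact: convex_function_comp STw (cgs j).
  apply: convex_functionD; first exact: convex_function_comp STw cg.
  exact: convex_function_linear.
move=> x /attained[y [F fE eq]]; exists y; split=> // y' F'.
by rewrite (eq _ F').
Qed.

End Graph.

Theorem proposition2p4 (R : realType) (n : nat) (S1 : set 'cV[R]_n)
    (hS1 : @convex_set R 'cV[R]_n S1) (f1 f2 : 'cV[R]_n -> R) :
  (CN S1 f1 -> CN S1 f2 ->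
     forall a1 a2 : R, 0 < a1 -> 0 < a2 ->
     CN S1 (fun x => a1 * f1 x + a2 * f2 x)) /\
  (weak_uniform_CN S1 f1 -> weak_uniform_CN S1 f2 ->
     forall a1 a2 : R, 0 < a1 -> 0 < a2 ->
     weak_uniform_CN S1 (fun x => a1 * f1 x + a2 * f2 x)) /\
  (strong_uniform_CN S1 f1 -> strong_uniform_CN S1 f2 ->
     forall a1 a2 : R, 0 < a1 -> 0 < a2 ->
     strong_uniform_CN S1 (fun x => a1 * f1 x + a2 * f2 x)) /\
  (exact_CN S1 f1 -> exact_CN S1 f2 ->
     forall a1 a2 : R, 0 < a1 -> 0 < a2 ->
     exact_CN S1 (fun x => a1 * f1 x + a2 * f2 x)) /\
  (weak_uniform_exact_CN S1 f1 -> weak_uniform_exact_CN S1 f2 ->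
     forall a1 a2 : R, 0 < a1 -> 0 < a2 ->
     weak_uniform_exact_CN S1 (fun x => a1 * f1 x + a2 * f2 x)) /\
  (strong_uniform_exact_CN S1 f1 -> strong_uniform_exact_CN S1 f2 ->
     forall a1 a2 : R, 0 < a1 -> 0 < a2 ->
     strong_uniform_exact_CN S1 (fun x => a1 * f1 x + a2 * f2 x)) /\
  (exact_CN S1 f1 -> exact_CN S1 f2 ->
     forall a1 a2 : R, exact_CN S1 (fun x => a1 * f1 x + a2 * f2 x)).
Proof.
split; last split; last split; last split; last split; last split.
- move=> [m1 [r1 [T1 [g1 [gs1 D1]]]]] [m2 [r2 [T2 [g2 [gs2 D2]]]]] a1 a2 a10 a20.
  do 5!eexists; exact: CN_data_glue (CN_dataZ a10 D1) (CN_dataZ a20 D2).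
- move=> [m1 [r1 [T1 [g1 [gs1 [D1 U1]]]]]] [m2 [r2 [T2 [g2 [gs2 [D2 U2]]]]]].
  move=> a1 a2 a10 a20; do 5!eexists; split.
    exact: CN_data_glue (CN_dataZ a10 D1) (CN_dataZ a20 D2).
  by apply: weak_uniform_glue_objective; exact: weak_uniform_convexZ.
- move=> [m1 [r1 [T1 [g1 [gs1 [D1 U1]]]]]] [m2 [r2 [T2 [g2 [gs2 [D2 U2]]]]]].
  move=> a1 a2 a10 a20; do 5!eexists; split.
    exact: CN_data_glue (CN_dataZ a10 D1) (CN_dataZ a20 D2).
  by apply: strong_uniform_glue_objective; exact: strong_uniform_convexZ.
- move=> [m1 [r1 [T1 [g1 [gs1 D1]]]]] [m2 [r2 [T2 [g2 [gs2 D2]]]]] a1 a2 a10 a20.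
  do 5!eexists.
  exact: exact_CN_data_glue (exact_CN_dataZ a10 D1) (exact_CN_dataZ a20 D2).
- move=> [m1 [r1 [T1 [g1 [gs1 [D1 U1]]]]]] [m2 [r2 [T2 [g2 [gs2 [D2 U2]]]]]].
  move=> a1 a2 a10 a20; do 5!eexists; split.
    exact: exact_CN_data_glue (exact_CN_dataZ a10 D1) (exact_CN_dataZ a20 D2).
  by apply: weak_uniform_glue_objective; exact: weak_uniform_convexZ.
- move=> [m1 [r1 [T1 [g1 [gs1 [D1 U1]]]]]] [m2 [r2 [T2 [g2 [gs2 [D2 U2]]]]]].
  move=> a1 a2 a10 a20; do 5!eexists; split.
    exact: exact_CN_data_glue (exact_CN_dataZ a10 D1) (exact_CN_dataZ a20 D2).
  by apply: strong_uniform_glue_objective; exact: strong_uniform_convexZ.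
- move=> [m1 [r1 [T1 [g1 [gs1 D1]]]]] [m2 [r2 [T2 [g2 [gs2 D2]]]]] a1 a2.
  do 5!eexists; exact: exact_CN_data_glue (exact_CN_data_scale_any a1 D1)
                                          (exact_CN_data_scale_any a2 D2).
Qed.
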